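(* Let $X$ be a non-empty set. Then $\mathsf{FFR}(X)$, $\mathsf{FFR}_s(X)$ and $\mathsf{FFR}_p(X)$ are left ample.
   Context: A restriction semigroup is an algebra $(R;\cdot,{}^+)$ of type $(2,1)$ such that $(R;\cdot)$ is a semigroup and the identities $x^+x=x$, $x^+y^+=y^+x^+$, $(x^+y)^+=x^+y^+$, $xy^+=(xy)^+x$ hold. It is called left ample if it satisfies the quasi-identity $xz=yz\rightarrow xz^+=yz^+$. Its set of projections is $P(R)=\{s^+ : s\in R\}$. The natural partial order is $s\le t$ iff $s=et$ for some $e\in P(R)$. The congruence $\sigma$ is the minimum congruence identifying all projections: $s\mathrel{\sigma}t$ iff $es=et$ for some $e\in P(R)$. An $F$-restriction semigroup is a restriction semigroup in which every $\sigma$-class has a maximum element with respect to $\le$; the maximum element of the $\sigma$-class of $s$ is denoted $s^{\mathfrak{m}}$. It has a maximum projection, denoted $\lambda$, which is its unique left identity. It is strong if $s^{\mathfrak{m}}t^{\mathfrak{m}}=(s^{\mathfrak{m}})^+(st)^{\mathfrak{m}}$ for all $s,t$, and perfect if $s^{\mathfrak{m}}t^{\mathfrak{m}}=(st)^{\mathfrak{m}}$ and $(s^{\mathfrak{m}})^+=\lambda$ for all $s,t$. Regarded as algebras in the signature $(\cdot,{}^+,{}^{\mathfrak{m}},\lambda)$ of type $(2,1,1,0)$, the $F$-restriction semigroups, the strong ones and the perfect ones each form a variety; the free $X$-generated objects of these three varieties are denoted $\mathsf{FFR}(X)$, $\mathsf{FFR}_s(X)$ and $\mathsf{FFR}_p(X)$,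 respectively. *)

(* Defs.v *)
From mathcomp Require Import all_boot.

Set Implicit Arguments.
Unset Strict Implicit.
Unset Printing Implicit Defensive.

Declare Scope restriction_scope.
Delimit Scope restriction_scope with RS.

(* Not built on MathComp's [semigroupType], which carries a choice operator
   that is not part of the algebraic structure. *)
Record restrictionSemigroup : Type := RestrictionSemigroup {
  carrier :> Type;
  mul : carrier -> carrier -> carrier;
  plus : carrier -> carrier;
  mulA : associative mul;
  plus_mul : forall x, mul (plus x) x = x;
  plusC : forall x y, mul (plus x) (plus y) = mul (plus y) (plus x);
  plusM : forall x y, plus (mul (plus x) y) = mul (plus x) (plus y);
  mul_plus : forall x y, mul x (plus y) = mul (plus (mul x y)) x
}.

Notation "x * y" := (mul x y) : restriction_scope.
Notation "x ^{+}" := (plus x)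
  (at level 2, left associativity, format "x ^{+}")
  : restriction_scope.

Local Open Scope restriction_scope.

Section RestrictionSemigroup.
Variable R : restrictionSemigroup.
Implicit Types (s t e x y z : R).

Definition left_ample : Prop :=
  forall x y z, x * z = y * z -> x * z^{+} = y * z^{+}.

Definition projection e : Prop := exists s, e = s^{+}.

Definition natural_le s t : Prop := exists2 e, projection e & s = e * t.

Definition sigma s t : Prop := exists2 e, projection e & e * s = e * t.

Definition congruence (r : R -> R -> Prop) : Prop :=
  [/\ [/\ forall x, r x x,
          forall x y, r x y -> r y x
        & forall x y z, r x y -> r y z -> r x z],
      forall x x' y y', r x x' -> r y y' -> r (x * y) (x' * y')
    & forall x x', r x x' -> r x^{+} x'^{+}].

Definition identifies_projections (r : R -> R -> Prop) : Prop :=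
  forall e f : R, projection e -> projection f -> r e f.

Definition is_max (A : R -> Prop) m : Prop :=
  A m /\ forall t, A t -> natural_le t m.

Lemma plus_idem x : x^{+} * x^{+} = x^{+}.
Proof. by rewrite -plusM plus_mul. Qed.

Lemma projection_plus s : projection s^{+}.
Proof. by exists s. Qed.

Lemma projectionM e f : projection e -> projection f -> projection (e * f).
Proof. by move=> [s ->] [t ->]; exists (s^{+} * t); rewrite plusM. Qed.

Lemma sigma_identifies_projections : identifies_projections sigma.
Proof.
move=> _ _ [s ->] [t ->]; exists (s^{+} * t^{+}).
  exact: projectionM (projection_plus s) (projection_plus t).
by rewrite -[RHS]mulA plus_idem plusC -mulA plus_idem.
Qed.

Lemma sigma_congruence : congruence sigma.
Proof.
have trans x y z : sigma x y -> sigma y z -> sigma x z.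
  move=> [_ [s ->] exy] [_ [t ->] fyz]; exists (s^{+} * t^{+}).
    exact: projectionM (projection_plus s) (projection_plus t).
  by rewrite -[RHS]mulA -fyz !mulA plusC -!mulA exy.
split; first split => //.
- by move=> x; exists x^{+} => //; exact: projection_plus.
- by move=> x y [e Pe exy]; exists e.
- move=> x x' y y' [e Pe exx'] [_ [s ->] eyy']; apply: (trans _ (x' * y)).
    by exists e => //; rewrite !mulA exx'.
  exists (x' * s)^{+}; first exact: projection_plus.
  by rewrite !mulA -mul_plus -!mulA eyy'.
- move=> x x' _.
  exact: sigma_identifies_projections (projection_plus x) (projection_plus x').
Qed.

Lemma sigma_minimum (r : R -> R -> Prop) :
  congruence r -> identifies_projections r -> forall s t, sigma s t -> r s t.
Proof.
move=> [[refl sym trans] rM _] rP s t [e Pe est].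
have absorb x : r x (e * x).
  rewrite -{1}(plus_mul x); apply: rM (refl x).
  exact: rP (projection_plus x) Pe.
by apply: trans (absorb s) _; rewrite est; exact: sym.
Qed.

End RestrictionSemigroup.

(* Homomorphisms below preserve [mx] and [lam] as well: this is the
   signature (mul, plus, mx, lam) of type (2, 1, 1, 0). *)
Record FRestrictionSemigroup : Type := FRestriction {
  base :> restrictionSemigroup;
  mx : base -> base;
  lam : base;
  mxP : forall s, is_max (sigma s) (mx s);
  lamP : is_max (@projection base) lam
}.

Notation "x ^{m}" := (mx x) (at level 2, left associativity, format "x ^{m}")
  : restriction_scope.

Definition any_F_restriction (_ : FRestrictionSemigroup) : Prop := True.

Definition strong (R : FRestrictionSemigroup) : Prop :=
  forall s t : R, s^{m} * t^{m} = (s^{m})^{+} * (s * t)^{m}.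

Definition perfect (R : FRestrictionSemigroup) : Prop :=
  forall s t : R, s^{m} * t^{m} = (s * t)^{m} /\ (s^{m})^{+} = lam R.

Definition homomorphism (R S : FRestrictionSemigroup) (h : R -> S) : Prop :=
  [/\ forall x y, h (x * y) = h x * h y,
      forall x, h x^{+} = (h x)^{+},
      forall x, h x^{m} = (h x)^{m}
    & h (lam R) = lam S].

(* [F], with generators given by [i], is the free [X]-generated object of the
   class [V]; uniqueness of morphisms is pointwise. *)
Definition free_object (V : FRestrictionSemigroup -> Prop) (X : Type)
    (F : FRestrictionSemigroup) (i : X -> F) : Prop :=
  V F /\
  forall S : FRestrictionSemigroup, V S -> forall f : X -> S,
    (exists2 h : F -> S, homomorphism h & forall x, h (i x) = f x) /\
    (forall h h' : F -> S, homomorphism h -> homomorphism h' ->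
       (forall x, h (i x) = h' (i x)) -> forall a, h a = h' a).

Definition is_FFR := free_object any_F_restriction.
Definition is_FFR_s := free_object strong.
Definition is_FFR_p := free_object perfect.

(* Main.v *)
From Stdlib Require Import ProofIrrelevance.
From mathcomp Require Import all_boot.
Require Import Defs.

(** In an F-restriction semigroup, s = s^{+} s^{m}, so an element is determined
    by its projection and its sigma-class ([plus_sigma_inj]).  If x z = y z, then
    x z^{+} and y z^{+} have the same projection, because (x z^{+})^{+} =
    (x z)^{+} holds in every restriction semigroup.  Left ampleness of [F]
    therefore follows as soon as x z = y z forces x sigma y, that is, as soon as
    F / sigma is right cancellative ([left_ample_of_sigma_cancel]).

    For a free object F this quotient is the free monoid on X.  Every monoid is a
    perfect F-restriction semigroup once all its elements are sent to 1 by plus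
    and fixed by mx, so both X* and F / sigma are admissible targets in each of
    the three varieties.  Freeness provides a morphism h from F to X*, and
    the monoid morphism from X* to F / sigma extending the generators, composed
    with h, agrees on generators with the projection from F to F / sigma.  Hence
    the projection factors through h ([free_sigma_cancel]), and cancellation in
    X* transfers to F / sigma. *)

Local Open Scope restriction_scope.

(** * Left ampleness and right cancellation modulo sigma *)

Lemma natural_le_antisym {R : restrictionSemigroup} (s t : R) :
  natural_le s t -> natural_le t s -> s = t.
Proof.
move=> [e [a e_a] s_et] [f [b f_b] t_fs]; subst e f.
have as_s : a^{+} * s = s by rewrite {2}s_et s_et mulA plus_idem.
by rewrite [LHS]s_et t_fs mulA plusC -mulA as_s.
Qed.

(** Since x z^{+} = (x z)^{+} x, its projection is (x z)^{+} x^{+}, and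
    (x z)^{+} lies below x^{+}. *)
Lemma plus_mul_plus {R : restrictionSemigroup} (x z : R) :
  (x * z^{+})^{+} = (x * z)^{+}.
Proof. by rewrite mul_plus plusM plusC -plusM mulA plus_mul. Qed.

Section Sigma.
Variable F : FRestrictionSemigroup.
Implicit Types (s t x y z : F).

Lemma sigmaxx s : sigma s s.
Proof. by have [[refl _ _] _ _] := sigma_congruence F; exact: refl. Qed.

Lemma sigma_sym s t : sigma s t -> sigma t s.
Proof. by have [[_ sym _] _ _] := sigma_congruence F; exact: sym. Qed.

Lemma sigma_trans t s u : sigma s t -> sigma t u -> sigma s u.
Proof. by have [[_ _ trans] _ _] := sigma_congruence F; exact: trans. Qed.

Lemma sigmaM s s' t t' : sigma s s' -> sigma t t' -> sigma (s * t) (s' * t').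
Proof. by have [_ cM _] := sigma_congruence F; exact: cM. Qed.

Lemma sigma_mx s : sigma s s^{m}.
Proof. by case: (mxP s). Qed.

Lemma mx_sigma s t : s^{m} = t^{m} -> sigma s t.
Proof.
move=> eq_m; apply: sigma_trans (sigma_mx s) _; rewrite eq_m.
exact: sigma_sym (sigma_mx t).
Qed.

Lemma sigma_mx_eq s t : sigma s t -> s^{m} = t^{m}.
Proof.
move=> st; have [s_m max_s] := mxP s; have [t_m max_t] := mxP t.
apply: natural_le_antisym; first exact: max_t (sigma_trans s _ _ (sigma_sym _ _ st) s_m).
exact: max_s (sigma_trans t _ _ st t_m).
Qed.

(** By maximality s = a^{+} s^{m} for some a; any such a^{+} may be replaced by
    s^{+}, which lies below it. *)
Lemma plus_mx s : s^{+} * s^{m} = s.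
Proof.
have [_ max_s] := mxP s; have [_ [a ->] s_am] := max_s s (sigmaxx s).
have ps : s^{+} = a^{+} * s^{+} by rewrite -plusM {2}s_am mulA plus_idem -s_am.
by rewrite ps plusC -mulA -s_am plus_mul.
Qed.

Lemma plus_sigma_inj s t : s^{+} = t^{+} -> sigma s t -> s = t.
Proof. by move=> eq_p /sigma_mx_eq eq_m; rewrite -(plus_mx s) eq_p eq_m plus_mx. Qed.

(** Two elements x and y with x z = y z always give x z^{+} and y z^{+} the same
    projection, so it only remains to put these in the same sigma-class. *)
Lemma left_ample_of_sigma_cancel :
  (forall x y z, x * z = y * z -> sigma x y) -> left_ample F.
Proof.
move=> cancel x y z xz_yz; apply: plus_sigma_inj.
  by rewrite !plus_mul_plus xz_yz.
exact: sigmaM (cancel x y z xz_yz) (sigmaxx _).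
Qed.

Lemma sigma_lamM s : sigma (lam F * s) s.
Proof.
have [Plam _] := @lamP F; rewrite -{2}(plus_mul s).
apply: sigmaM (sigmaxx s).
exact: sigma_identifies_projections Plam (projection_plus s).
Qed.

Lemma sigma_Mlam s : sigma (s * lam F) s.
Proof.
have [[a lam_a] _] := @lamP F.
rewrite lam_a mul_plus -{3}(plus_mul s); apply: sigmaM (sigmaxx s).
exact: sigma_identifies_projections (projection_plus _) (projection_plus s).
Qed.

End Sigma.

(** * Monoids as F-restriction semigroups *)

Section Reduced.
Context {T : Type} {op : T -> T -> T} {one : T}.
Hypotheses (opA : associative op) (op1x : left_id one op) (opx1 : right_id one op).

Definition reduced_restriction : restrictionSemigroup.
Proof.
by refine (@RestrictionSemigroup T op (fun _ => one) opA op1x _ _ _) => *;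
  rewrite ?op1x ?opx1.
Defined.

(** As [one] is the only projection, sigma is equality and every element is the
    maximum of its own class. *)
Definition reduced : FRestrictionSemigroup.
Proof.
refine (@FRestriction reduced_restriction id one _ _).
- move=> s; split; first by exists one; first exists one.
  move=> t [e [a e_one]]; rewrite {}e_one /= !op1x => ->.
  by exists one; [exists one | rewrite /= op1x].
- split; first by exists one.
  by move=> e [a ->]; exists one; [exists one | rewrite /= op1x].
Defined.

Lemma reduced_perfect : perfect reduced.
Proof. by []. Qed.

Lemma reduced_strong : strong reduced.
Proof. by move=> s t; rewrite /= op1x. Qed.

End Reduced.

Arguments reduced {T op one} opA op1x opx1.

Lemma cat_cancelr {X : Type} (u v w : seq X) : u ++ w = v ++ w -> u = v.
Proof.
move=> uw_vw; have := congr1 size uw_vw; rewrite !size_cat => /addIn size_uv.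
by rewrite -(take_size_cat w (erefl (size u))) uw_vw take_size_cat.
Qed.

(** The free monoid X*. *)
Definition word_reduced (X : Type) : FRestrictionSemigroup :=
  reduced (@catA X) (@cat0s X) (@cats0 X).

Definition word_value {T X : Type} (op : T -> T -> T) (one : T) (f : X -> T)
    (w : seq X) : T :=
  foldr (fun x t => op (f x) t) one w.

Lemma word_value_hom {T X : Type} {op : T -> T -> T} {one : T} (f : X -> T)
    (opA : associative op) (op1x : left_id one op) (opx1 : right_id one op) :
  @homomorphism (word_reduced X) (reduced opA op1x opx1) (word_value op one f).
Proof.
by split=> //=; elim=> [|x u IH] v /=; rewrite ?op1x // IH opA.
Qed.

(** * The quotient of an F-restriction semigroup by sigma *)

Section Quotient.
Variable F : FRestrictionSemigroup.

(** The maxima of the sigma-classes form a transversal of sigma, so this subtype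
    represents F / sigma; equality in it is equality of the underlying maxima by
    irrelevance of the proofs of s^{m} = s. *)
Definition sigma_quot : Type := {s : F | s^{m} = s}.

Lemma mx_idem (s : F) : (s^{m})^{m} = s^{m}.
Proof. exact/esym/sigma_mx_eq/sigma_mx. Qed.

Definition sigma_proj (s : F) : sigma_quot := exist _ s^{m} (mx_idem s).

Lemma sigma_proj_eq (s t : F) : sigma s t -> sigma_proj s = sigma_proj t.
Proof. by move=> /sigma_mx_eq st; exact: subset_eq_compat. Qed.

Lemma sigma_proj_sigma (s t : F) : sigma_proj s = sigma_proj t -> sigma s t.
Proof. by case=> /mx_sigma. Qed.

Lemma svalK_sigma_proj (q : sigma_quot) : sigma_proj (sval q) = q.
Proof. by case: q => s s_max; exact: subset_eq_compat. Qed.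

Definition sigma_quot_mul (p q : sigma_quot) : sigma_quot :=
  sigma_proj (sval p * sval q).

Lemma sigma_projM (s t : F) :
  sigma_proj (s * t) = sigma_quot_mul (sigma_proj s) (sigma_proj t).
Proof. by apply/sigma_proj_eq/sigmaM; exact: sigma_mx. Qed.

Lemma sigma_quot_mulA : associative sigma_quot_mul.
Proof.
move=> p q r; rewrite -(svalK_sigma_proj p) -(svalK_sigma_proj q).
by rewrite -(svalK_sigma_proj r) -!sigma_projM mulA.
Qed.

Lemma sigma_quot_mul1q : left_id (sigma_proj (lam F)) sigma_quot_mul.
Proof.
move=> q; rewrite -(svalK_sigma_proj q) -sigma_projM.
exact/sigma_proj_eq/sigma_lamM.
Qed.

Lemma sigma_quot_mulq1 : right_id (sigma_proj (lam F)) sigma_quot_mul.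
Proof.
move=> q; rewrite -(svalK_sigma_proj q) -sigma_projM.
exact/sigma_proj_eq/sigma_Mlam.
Qed.

Definition sigma_reduced : FRestrictionSemigroup :=
  reduced sigma_quot_mulA sigma_quot_mul1q sigma_quot_mulq1.

(** The operation plus is respected because every projection, like [lam F],
    belongs to the class that is the unit of the quotient. *)
Lemma sigma_proj_hom : @homomorphism F sigma_reduced sigma_proj.
Proof.
split=> // [|s|s] /=; first exact: sigma_projM.
  have [Plam _] := @lamP F; apply: sigma_proj_eq.
  exact: sigma_identifies_projections (projection_plus s) Plam.
exact/sigma_proj_eq/sigma_sym/sigma_mx.
Qed.

End Quotient.

(** * Free objects *)

Lemma homomorphism_comp {R S T : FRestrictionSemigroup} (g : S -> T) (h : R -> S) :
  homomorphism g -> homomorphism h -> homomorphism (g \o h).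
Proof.
move=> [gM gp gm gl] [hM hp hm hl].
by split=> [x y|x|x|] /=; rewrite ?hM ?hp ?hm ?hl.
Qed.

(** The argument is uniform in the class [V]: it only requires that [V] contain
    every monoid, viewed as an F-restriction semigroup. *)
Section Free.
Variables (V : FRestrictionSemigroup -> Prop) (X : Type).
Variables (F : FRestrictionSemigroup) (i : X -> F).
Hypothesis V_reduced : forall (T : Type) (op : T -> T -> T) (one : T)
  (opA : associative op) (op1x : left_id one op) (opx1 : right_id one op),
  V (reduced opA op1x opx1).
Hypothesis F_free : free_object V i.

(** The morphism to X* separates sigma-classes, since evaluating words in F / sigma
    after it gives back the projection; right cancellation is then inherited
    from X*. *)
Lemma free_sigma_cancel (x y z : F) : x * z = y * z -> sigma x y.
Proof.
have [_ univ] := F_free.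
have [[h h_hom h_gen] _] :=
  univ (word_reduced X) (V_reduced _ _ _ _ _ _) (fun x => [:: x]).
have [_ uniq] := univ (sigma_reduced F) (V_reduced _ _ _ _ _ _)
  (fun x => sigma_proj F (i x)).
set g := word_value (@sigma_quot_mul F) (sigma_proj F (lam F))
  (fun x => sigma_proj F (i x)).
have gh : forall a, g (h a) = sigma_proj F a.
  apply: uniq (homomorphism_comp _ _ (word_value_hom _ _ _ _) h_hom)
    (sigma_proj_hom F) _ => a.
  by rewrite /= h_gen /= sigma_quot_mulq1.
move=> xz_yz; apply: sigma_proj_sigma; rewrite -!gh.
have [hM _ _ _] := h_hom.
congr g; apply: (@cat_cancelr X _ _ (h z)).
by have := congr1 h xz_yz; rewrite !hM.
Qed.

Lemma free_left_ample : left_ample F.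
Proof. exact: left_ample_of_sigma_cancel free_sigma_cancel. Qed.

End Free.

Theorem proposition7p2 (X : Type) (X_nonempty : inhabited X) :
  (forall (F : FRestrictionSemigroup) (i : X -> F),
     is_FFR i -> left_ample F) /\
  (forall (F : FRestrictionSemigroup) (i : X -> F),
     is_FFR_s i -> left_ample F) /\
  (forall (F : FRestrictionSemigroup) (i : X -> F),
     is_FFR_p i -> left_ample F).
Proof.
split; last split=> [|] F i F_free; first by move=> F i; exact: free_left_ample.
  by apply: free_left_ample F_free => *; exact: reduced_strong.
by apply: free_left_ample F_free => *; exact: reduced_perfect.
Qed.
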